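(* Suppose that $\lambda_w$ ($w\in\mathcal{U}(\mathcal{O}_2)$) is an extendable endomorphism of $\mathcal{O}_2$. If $\lambda_w$ admits a unique extension $\tilde\lambda_w$ to $\mathcal{Q}_2$, then $$\lambda_w(\mathcal{O}_2)'\cap\mathcal{Q}_2\subseteq C^*(\tilde\lambda_w(u))'\cap\mathcal{Q}_2 .$$
   Context: The 2-adic ring $C^*$-algebra $\mathcal{Q}_2$ is the universal unital $C^*$-algebra generated by a unitary $u$ and an isometry $s_2$ with $s_2u=u^2s_2$ and $s_2s_2^*+us_2s_2^*u^*=1$. Put $s_1:=us_2$; then $\mathcal{O}_2:=C^*(s_1,s_2)\subseteq\mathcal{Q}_2$ is the canonical copy of the Cuntz algebra. Endomorphisms are unital $*$-endomorphisms. For $w\in\mathcal{U}(\mathcal{O}_2)$ (the unitary group), $\lambda_w\in\operatorname{End}(\mathcal{O}_2)$ is determined by $\lambda_w(s_i)=ws_i$ ($i=1,2$). $\lambda_w$ is extendable if some element of $\operatorname{End}(\mathcal{Q}_2)$ restricts to $\lambda_w$ on $\mathcal{O}_2$; any such element is called an extension of $\lambda_w$ to $\mathcal{Q}_2$. $B'\cap\mathcal{Q}_2$ is the relative commutant of $B$ in $\mathcal{Q}_2$. *)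

(* Defs.v *)
From HB Require Import structures.
From mathcomp Require Import all_boot all_order all_algebra.
From mathcomp Require Import complex.
From mathcomp Require Import all_classical all_reals all_analysis.
Set Implicit Arguments.
Unset Strict Implicit.
Unset Printing Implicit Defensive.
Import Order.TTheory GRing.Theory Num.Theory numFieldNormedType.Exports.
Local Open Scope classical_set_scope.
Local Open Scope complex_scope.
Local Open Scope ring_scope.

(* The library has no structure joining its rings with its normed modules, and
   none can be declared downstream of [numDomainType].  The multiplication is
   therefore bundled by hand over [completeNormedModType R[i]], and the carrier
   is then equipped with the library's algebra structure, so that [1], [*],
   [*:], [`| |], [closed] below are the library's.  The norm takes its values
   in R[i], as for every normed module over R[i], and is real. *)
Record cstarAlg (R : realType) := CStarAlg {
  cstar_normed : completeNormedModType R[i] ;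
  cstar_one : cstar_normed ;
  cstar_mul : cstar_normed -> cstar_normed -> cstar_normed ;
  cstar_star : cstar_normed -> cstar_normed ;
  cstar_mulA : associative cstar_mul ;
  cstar_mul1l : left_id cstar_one cstar_mul ;
  cstar_mul1r : right_id cstar_one cstar_mul ;
  cstar_mulDl : left_distributive cstar_mul +%R ;
  cstar_mulDr : right_distributive cstar_mul +%R ;
  (* The zero algebra is excluded, as for every [algType]. *)
  cstar_one_neq0 : cstar_one != 0 ;
  cstar_scaleAl : forall (a : R[i]) x y,
    a *: cstar_mul x y = cstar_mul (a *: x) y ;
  cstar_scaleAr : forall (a : R[i]) x y,
    a *: cstar_mul x y = cstar_mul x (a *: y) ;
  cstar_starK : involutive cstar_star ;
  cstar_starD : {morph cstar_star : x y / x + y} ;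
  cstar_starZ : forall (a : R[i]) x,
    cstar_star (a *: x) = Num.conj a *: cstar_star x ;
  cstar_starM : forall x y,
    cstar_star (cstar_mul x y) = cstar_mul (cstar_star y) (cstar_star x) ;
  cstar_norm_mul_le : forall x y, `|cstar_mul x y| <= `|x| * `|y| ;
  cstar_norm_star_mul : forall x, `|cstar_mul (cstar_star x) x| = `|x| ^+ 2
}.

Definition cstar_sort (R : realType) (A : cstarAlg R) : Type := cstar_normed A.
Coercion cstar_sort : cstarAlg >-> Sortclass.

HB.instance Definition _ (R : realType) (A : cstarAlg R) :=
  CompleteNormedModule.copy (cstar_sort A) (cstar_normed A).
HB.instance Definition _ (R : realType) (A : cstarAlg R) :=
  GRing.Zmodule_isNzRing.Build (cstar_sort A)
    (@cstar_mulA R A) (@cstar_mul1l R A) (@cstar_mul1r R A)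
    (@cstar_mulDl R A) (@cstar_mulDr R A) (@cstar_one_neq0 R A).
HB.instance Definition _ (R : realType) (A : cstarAlg R) :=
  GRing.Lmodule_isLalgebra.Build R[i] (cstar_sort A) (@cstar_scaleAl R A).
HB.instance Definition _ (R : realType) (A : cstarAlg R) :=
  GRing.Lalgebra_isAlgebra.Build R[i] (cstar_sort A) (@cstar_scaleAr R A).

Definition star (R : realType) (A : cstarAlg R) (x : A) : A := cstar_star x.

Definition isometry_elt (R : realType) (A : cstarAlg R) (s : A) : Prop :=
  star s * s = 1.

Definition unitary (R : realType) (A : cstarAlg R) (u : A) : Prop :=
  star u * u = 1 /\ u * star u = 1.

Record cstar_subalgebra (R : realType) (A : cstarAlg R) (S : set A) : Prop :=
  CStarSubalgebra {
    cstar_subalgebra_closed : closed S ;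
    cstar_subalgebra0 : S 0 ;
    cstar_subalgebraD : forall x y, S x -> S y -> S (x + y) ;
    cstar_subalgebraZ : forall (a : R[i]) x, S x -> S (a *: x) ;
    cstar_subalgebraM : forall x y, S x -> S y -> S (x * y) ;
    cstar_subalgebra_star : forall x, S x -> S (star x)
  }.

Definition cstar_gen (R : realType) (A : cstarAlg R) (X : set A) : set A :=
  smallest (@cstar_subalgebra R A) X.

Definition rel_commutant (R : realType) (A : cstarAlg R) (B : set A) : set A :=
  [set x | forall b, B b -> x * b = b * x].

(* Unital *-homomorphism from the unital C*-subalgebra D of A to the unital
   C*-subalgebra E of B: only the values of f on D matter. *)
Record unital_star_hom (R : realType) (A B : cstarAlg R)
    (D : set A) (E : set B) (f : A -> B) : Prop := UnitalStarHom {
  star_hom_fun : set_fun D E f ;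
  star_hom1 : f 1 = 1 ;
  star_homD : forall x y, D x -> D y -> f (x + y) = f x + f y ;
  star_homZ : forall (a : R[i]) x, D x -> f (a *: x) = a *: f x ;
  star_homM : forall x y, D x -> D y -> f (x * y) = f x * f y ;
  star_hom_star : forall x, D x -> f (star x) = star (f x)
}.

Definition star_endo (R : realType) (A : cstarAlg R) (D : set A) (f : A -> A) :
  Prop := unital_star_hom D D f.

Record Q2_relations (R : realType) (A : cstarAlg R) (u s : A) : Prop :=
  Q2Relations {
    Q2_unitary : unitary u ;
    Q2_isometry : isometry_elt s ;
    Q2_commutation : s * u = u ^+ 2 * s ;
    Q2_range : s * star s + u * s * star s * star u = 1
  }.

(* Q, with the generators u and s2, is the 2-adic ring C*-algebra. The
   homomorphism given by universality is unique because u and s2 generate. *)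
Record is_Q2 (R : realType) (Q : cstarAlg R) (u s2 : Q) : Prop := IsQ2 {
  is_Q2_relations : Q2_relations u s2 ;
  is_Q2_generated : cstar_gen [set u; s2] = setT ;
  is_Q2_universal : forall (B : cstarAlg R) (v t : B), Q2_relations v t ->
    exists phi : Q -> B,
      [/\ unital_star_hom setT setT phi, phi u = v & phi s2 = t]
}.

Definition O2 (R : realType) (Q : cstarAlg R) (u s2 : Q) : set Q :=
  cstar_gen [set u * s2; s2].

(* lam is lambda_w; only its values on O_2 matter, and they are determined by
   the two equations since s_1 = u s_2 and s_2 generate O_2. *)
Definition is_lambda (R : realType) (Q : cstarAlg R) (u s2 w : Q)
    (lam : Q -> Q) : Prop :=
  [/\ star_endo (O2 u s2) lam,
      lam (u * s2) = w * (u * s2) & lam s2 = w * s2].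

Definition is_extension (R : realType) (Q : cstarAlg R) (u s2 : Q)
    (lam tlam : Q -> Q) : Prop :=
  star_endo setT tlam /\ (forall x, O2 u s2 x -> tlam x = lam x).

Definition extendable (R : realType) (Q : cstarAlg R) (u s2 : Q)
    (lam : Q -> Q) : Prop :=
  exists tlam : Q -> Q, is_extension u s2 lam tlam.

(* Main.v *)
(* If a unitary U commutes with the range of lambda_w, then x |-> U tlam(x) U*
   is again an extension of lambda_w, so by uniqueness U commutes with tlam(u).
   The relative commutant is a *-algebra, and each of its self-adjoint elements
   is recovered from a unitary, its Cayley transform, which commutes with the
   same elements; hence the whole commutant commutes with tlam(u). *)

Require Import Defs.
From mathcomp Require Import all_boot all_order all_algebra.
From mathcomp Require Import complex.
From mathcomp Require Import all_classical all_reals all_analysis.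
Import Order.TTheory GRing.Theory Num.Theory numFieldNormedType.Exports.
Local Open Scope classical_set_scope.
Local Open Scope ring_scope.

(** Norms take values in [R[i]], so geometric decay is needed there. Being comparable with 0, [q]
    and [e] are real, and the decay in [R] transfers. *)
Lemma complex_expr_near_lt (R : realType) (q e : R[i]) :
  0 <= q -> q < 1 -> 0 < e -> \forall n \near \oo, q ^+ n < e.
Proof.
move=> q0 q1 e0.
have qE := RRe_real (ger0_real q0); have eE := RRe_real (gtr0_real e0).
move: q0 q1 e0; rewrite -qE -eE.
move: (complex.Re q) (complex.Re e) => r s.
rewrite !lecR !ltcR => r0 r_lt1 s0.
have r1 : `|r| < 1 by rewrite ger0_norm.
have /cvgrPdist_lt /(_ _ s0) := cvg_expr r1.
apply: filterS => n; rewrite sub0r normrN ger0_norm ?exprn_ge0// => rs.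
by rewrite -rmorphXn ltcR.
Qed.

Section CStar.
Context {R : realType} {A : cstarAlg R}.
Implicit Types (x y c a U : A) (k : R[i]).

Lemma starK : involutive (@star R A).
Proof. exact: cstar_starK. Qed.

Lemma starM x y : star (x * y) = star y * star x.
Proof. exact: cstar_starM. Qed.

Lemma starD x y : star (x + y) = star x + star y.
Proof. exact: cstar_starD. Qed.

Lemma starZ k x : star (k *: x) = Num.conj k *: star x.
Proof. exact: cstar_starZ. Qed.

Lemma starN x : star (- x) = - star x.
Proof. by rewrite -scaleN1r starZ rmorphN1 scaleN1r. Qed.

Lemma starB x y : star (x - y) = star x - star y.
Proof. by rewrite starD starN. Qed.

Lemma star1 : star (1 : A) = 1.
Proof. by rewrite -[LHS]mulr1 -{2}(starK 1) -starM mulr1 starK. Qed.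

Lemma cstar_normM x y : `|x * y| <= `|x| * `|y|.
Proof. exact: cstar_norm_mul_le. Qed.

Lemma cstar_normX x n : `|x ^+ n| <= `|1 : A| * `|x| ^+ n.
Proof.
elim: n => [|n IH]; first by rewrite !expr0 mulr1.
rewrite !exprSr mulrA; apply: le_trans (cstar_normM _ _) _.
exact: ler_wpM2r.
Qed.

Lemma lipschitz_continuous (f : A -> A) k :
  (forall x y, `|f x - f y| <= k * `|x - y|) -> 0 <= k -> continuous f.
Proof.
move=> fk k0 x; apply/(@cvgrPdist_lt _ _ _ (nbhs x)) => e e0; near=> y.
apply: le_lt_trans (fk _ _) _.
(* [k + 1] is positive even when [k = 0], so it can be divided by. *)
apply: (@le_lt_trans _ _ ((k + 1) * `|x - y|)).
  by rewrite ler_wpM2r// lerDl.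
rewrite -ltr_pdivlMl ?ltr_wpDl//; near: y.
by apply: cvgr_dist_lt => //; rewrite mulr_gt0 ?invr_gt0 ?ltr_wpDl.
Unshelve. all: by end_near. Qed.

Lemma mull_continuous x : continuous (fun y : A => x * y).
Proof.
apply: (lipschitz_continuous _ `|x|) => // y z.
by rewrite -mulrBr cstar_normM.
Qed.

Lemma mulr_continuous x : continuous (fun y : A => y * x).
Proof.
apply: (lipschitz_continuous _ `|x|) => // y z.
by rewrite -mulrBl (mulrC (`|x|)); exact: cstar_normM.
Qed.

Lemma closed_commuting x : closed [set y : A | x * y = y * x].
Proof.
rewrite (_ : mkset _ = (fun y => x * y - y * x) @^-1` [set 0]).
  apply: preimage_closed; last first.
    exact/accessible_closed_set1/hausdorff_accessible/norm_hausdorff.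
  move=> y _; apply: cvgB; [exact: mull_continuous|exact: mulr_continuous].
by apply/seteqP; split=> y /= ; [move=> ->; rewrite subrr|move/subr0_eq].
Qed.

(** The elements commuting with both [x] and [star x] form a C*-subalgebra; asking for both makes it
    stable under [star], since taking adjoints exchanges the two conditions. *)
Lemma rel_commutant_cstar_gen1 x y :
  x * y = y * x -> star x * y = y * star x ->
  rel_commutant (cstar_gen [set y]) x.
Proof.
move=> xy sxy b; move/(_ [set z | x * z = z * x /\ star x * z = z * star x]).
move=> /(_ _)[]//; split; last by move=> _ ->.
split=> /=.
- by apply: closedI; exact: closed_commuting.
- by rewrite !mulr0 !mul0r.
- by move=> a b' [a1 a2] [b1 b2]; rewrite !mulrDl !mulrDr a1 a2 b1 b2.
- by move=> k a [a1 a2]; rewrite -!scalerAl -!scalerAr a1 a2.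
- by move=> a b' [a1 a2] [b1 b2]; rewrite !mulrA a1 a2 -!mulrA b1 b2.
- move=> a [a1 a2]; split; apply: (can_inj starK).
    by rewrite !starM !starK a2.
  by rewrite !starM !starK a1.
Qed.

(** Geometric tail bound: the factor [1 - |c|] makes the sum of the [|c| ^+ i] telescope. The factor
    [|1|] is inherited from [cstar_normX], whose induction starts at exponent 0. *)
Lemma normr_sum_expr_tail c N m : `|c| < 1 ->
  (1 - `|c|) * `|\sum_(i < N) c ^+ i - \sum_(i < N + m) c ^+ i|
    <= `|1 : A| * (`|c| ^+ N - `|c| ^+ (N + m)).
Proof.
move=> c1; have d0 : 0 <= 1 - `|c| by rewrite subr_ge0 ltW.
elim: m => [|m IH]; first by rewrite addn0 !subrr normr0 !mulr0.
rewrite addnS big_ord_recr/= opprD addrA.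
apply: (@le_trans _ _ ((1 - `|c|) *
  (`|\sum_(i < N) c ^+ i - \sum_(i < N + m) c ^+ i| + `|c ^+ (N + m)|))).
  by rewrite ler_wpM2l// ler_normB.
rewrite mulrDr; apply: le_trans (lerD IH (ler_wpM2l d0 (cstar_normX _ _))) _.
by rewrite mulrCA -mulrDr mulrBl mul1r -exprS addrA subrK.
Qed.

(** The inverse is the Neumann series: its partial sums [S n] are Cauchy, hence converge by
    completeness, and [1 - c] times [S n], in either order, is [1 - c ^+ n], which tends to 1. *)
Lemma neumann_inverse c : `|c| < 1 ->
  exists y, (1 - c) * y = 1 /\ y * (1 - c) = 1.
Proof.
move=> c1; have d0 : 0 < 1 - `|c| by rewrite subr_gt0.
pose S n := \sum_(i < n) c ^+ i.
have K0 : 0 < `|1 : A| + 1 by rewrite ltr_wpDl.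
have cvX0 : c ^+ n @[n --> \oo] --> (0 : A).
  apply/cvgrPdist_lt => e e0.
  have := complex_expr_near_lt R `|c| (e / (`|1 : A| + 1)) (normr_ge0 _) c1.
  move=> /(_ (divr_gt0 e0 K0)); apply: filterS => n.
  rewrite ltr_pdivlMr// sub0r normrN => h.
  apply: le_lt_trans (cstar_normX _ _) (le_lt_trans _ h).
  by rewrite mulrC ler_wpM2l ?exprn_ge0// lerDl.
have cvX : (1 - c ^+ n) @[n --> \oo] --> (1 : A).
  by rewrite -[X in _ --> X](subr0 1); apply: cvgB => //; exact: cvg_cst.
have : cvg (S n @[n --> \oo]).
  apply/cauchy_cvgP/cauchy_exP => e e0.
  (* This threshold for [|c| ^+ N] turns the tail bound into [e] once [1 - |c|] is cancelled;
     [|1| + 1] dominates the factor [|1|]. *)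
  have f0 : 0 < e * (1 - `|c|) / (`|1 : A| + 1) by rewrite divr_gt0// mulr_gt0.
  have [N _ /(_ N (leqnn N)) hN] :=
    complex_expr_near_lt R `|c| _ (normr_ge0 _) c1 f0.
  exists (S N); exists N => // n /= Nn.
  rewrite -ball_normE /= -(subnKC Nn) -(ltr_pM2l d0).
  apply: le_lt_trans (normr_sum_expr_tail c N (n - N) c1) _.
  apply: (@le_lt_trans _ _ ((`|1 : A| + 1) * `|c| ^+ N)).
    apply: ler_pM => //; rewrite ?lerDl ?gerBl ?exprn_ge0//.
    by rewrite subr_ge0 ler_wiXn2l ?leq_addr// ltW.
  by move: hN; rewrite ltr_pdivlMr// mulrC [e * _]mulrC.
move=> /cvg_ex[L SL]; exists L.
have SE n : (1 - c) * S n = 1 - c ^+ n.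
  by rewrite -[RHS]opprB subrX1 -mulNr opprB.
have SE' n : S n * (1 - c) = 1 - c ^+ n.
  rewrite -SE mulrBr mulr1 mulrBl mul1r; congr (_ - _).
  rewrite mulr_suml mulr_sumr.
  by apply: eq_bigr => i _; rewrite -exprSr -exprS.
have hA := @norm_hausdorff _ A.
split; apply: (cvg_unique hA _ cvX).
- rewrite -(funext SE).
  exact: (cvg_comp _ _ SL (mull_continuous (1 - c) L)).
- rewrite -(funext SE').
  exact: (cvg_comp _ _ SL (mulr_continuous (1 - c) L)).
Qed.

Lemma commute_inverse x y z :
  x * y = 1 -> y * x = 1 -> x * z = z * x -> y * z = z * y.
Proof.
by move=> xy yx xz; rewrite -[LHS]mulr1 -xy mulrA -(mulrA y) -xz mulrA yx mul1r.
Qed.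

(* U = (1 + ita)/(1 - ita) = 2/(1 - ita) - 1 for small t > 0; no functional
   calculus is needed. *)
Lemma cayley_unitary a : star a = a ->
  exists U, unitary U /\ forall z, U * z = z * U <-> a * z = z * a.
Proof.
move=> aE.
(* This choice gives [|c| = |a| / (|a| + 1) < 1], and the factor ['i] makes [c] skew-adjoint, so
   that [1 + c] is the adjoint of [1 - c]. *)
pose t : R[i] := (`|a| + 1)^-1.
have a1 : 0 < `|a| + 1 by rewrite ltr_wpDl.
have t0 : 0 < t by rewrite invr_gt0.
have t_neq0 : 'i * t != 0 by rewrite mulf_neq0 ?neq0Ci ?gt_eqF.
pose c := ('i * t) *: a.
have cE : star c = - c.
  rewrite starZ aE rmorphM/= conjCi conj_Creal ?gtr0_real//.
  by rewrite mulNr scaleNr.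
have c1 : `|c| < 1.
  by rewrite normrZ normrM normCi mul1r gtr0_norm// ltr_pdivrMl// mulr1 ltrDl.
have [y [cy yc]] := neumann_inverse _ c1.
(* Taking adjoints of the inverse relations shows that [star y] is the inverse of [1 + c]. *)
have sy : star y * (1 + c) = 1.
  by move: (congr1 (@star R A) cy); rewrite starM starB star1 cE opprK.
have sy' : (1 + c) * star y = 1.
  by move: (congr1 (@star R A) yc); rewrite starM starB star1 cE opprK.
have cc : (1 - c) * (1 + c) = (1 + c) * (1 - c).
  by rewrite mulrBl mulrDl !mul1r mulrDr mulrBr !mulr1 opprD addrACA.
have yc' : y * (1 + c) = (1 + c) * y by apply: commute_inverse cc.
exists ((1 + c) * y); split; first split.
- rewrite starM starD star1 cE !mulrA -(mulrA (star y)) cc.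
  by rewrite mulrA sy mul1r cy.
- rewrite -yc' starM starD star1 cE !mulrA -(mulrA y) -cc.
  by rewrite mulrA yc mul1r sy'.
have UE : (1 + c) * y = 2 *: y - 1.
  rewrite -[X in _ - X]cy scaler_nat mulr2n mulrBl mulrDl !mul1r opprB.
  by rewrite addrACA subrr addr0.
have two_neq0 : (2 : R[i]) != 0 by rewrite pnatr_eq0.
(* Commutation with [z] passes from [U] to [y], then to its inverse [1 - c], then to [a], the
   scalars 2 and ['i * t] being nonzero; the converse runs backwards. *)
move=> z; rewrite UE; split=> h.
- have yz : y * z = z * y.
    move: h; rewrite mulrBl mulrBr mul1r mulr1 => /addIr.
    by rewrite -scalerAl -scalerAr => /(scalerI two_neq0).
  have := commute_inverse _ _ _ yc cy yz.
  rewrite mulrBl mulrBr mul1r mulr1 => /addrI/oppr_inj.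
  by rewrite -scalerAl -scalerAr => /(scalerI t_neq0).
- have cz : (1 - c) * z = z * (1 - c).
    by rewrite mulrBl mulrBr mul1r mulr1 -scalerAl -scalerAr h.
  have yz := commute_inverse _ _ _ cy yc cz.
  by rewrite mulrBl mulrBr mul1r mulr1 -scalerAl -scalerAr yz.
Qed.

Lemma unitary_conj_star_endo (f : A -> A) U :
  unitary U -> star_endo setT f -> star_endo setT (fun x => U * f x * star U).
Proof.
move=> [sUU UsU] [_ f1 fD fZ fM fs]; split=> //.
- by rewrite f1 mulr1.
- by move=> x y _ _; rewrite fD// mulrDr mulrDl.
- by move=> k x _; rewrite fZ// -scalerAr -scalerAl.
- by move=> x y _ _; rewrite fM// !mulrA -(mulrA _ (star U) U) sUU mulr1.
- by move=> x _; rewrite fs// !starM starK mulrA.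
Qed.

(** Twice [x] is [x + star x] plus [x - star x]; the first is self-adjoint, and so is ['i] times the
    second. *)
Lemma commute_of_selfadjoint (z : A) (P : A -> Prop) :
  (forall a, P a -> star a = a -> a * z = z * a) ->
  (forall x y, P x -> P y -> P (x + y)) ->
  (forall k x, P x -> P (k *: x)) ->
  (forall x, P x -> P (star x)) ->
  forall x, P x -> x * z = z * x.
Proof.
move=> Psa PD PZ Ps x Px.
have h1 : (x + star x) * z = z * (x + star x).
  by apply: Psa; [exact/PD/Ps|rewrite starD starK addrC].
have h2 : ('i *: (x - star x)) * z = z * ('i *: (x - star x)).
  apply: Psa.
    by rewrite -scaleN1r; apply/PZ/PD => //; apply/PZ/Ps.
  by rewrite starZ conjCi starB starK scaleNr -scalerN opprB.
move: h2; rewrite -scalerAl -scalerAr => /(scalerI (neq0Ci _)) h2.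
have two_neq0 : (2 : R[i]) != 0 by rewrite pnatr_eq0.
apply: (scalerI two_neq0); rewrite scalerAl scalerAr.
rewrite (_ : 2 *: x = (x + star x) + (x - star x)); last first.
  by rewrite scaler_nat mulr2n addrACA addrN addr0.
by rewrite mulrDl mulrDr h1 h2.
Qed.

End CStar.

Theorem proposition4p5 (R : realType) (Q : cstarAlg R) (u s2 : Q)
    (hQ : is_Q2 u s2)
    (w : Q) (hw : O2 u s2 w) (hwu : unitary w)
    (lam : Q -> Q) (hlam : is_lambda u s2 w lam)
    (hext : extendable u s2 lam)
    (tlam : Q -> Q) (huniq : unique (is_extension u s2 lam) tlam) :
  rel_commutant (lam @` O2 u s2) `<=` rel_commutant (cstar_gen [set tlam u]).
Proof.
have [[tendo text] tuniq] := huniq; have [lendo _ _] := hlam.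
set P := rel_commutant _ => x Px.
(* The range of [lam] on [O2] is stable under [star], so the adjoint of a commutation relation is
   again one. *)
have Ps y : P y -> P (star y).
  move=> Py _ [b Ob <-]; apply: (can_inj starK).
  rewrite !starM !starK -(star_hom_star lendo)// Py//.
  exists (star b) => //; move=> S [SA] /= SX.
  exact: (cstar_subalgebra_star SA (Ob S (conj SA SX))).
have PV y : P y -> y * tlam u = tlam u * y.
  apply: commute_of_selfadjoint => // [a Pa sa|a b Pa Pb z Oz|k a Pa z Oz].
  - have [U [uU Ucomm]] := cayley_unitary _ sa; apply/Ucomm.
    pose psi y := U * tlam y * star U.
    have psiE : is_extension u s2 lam psi.
      split=> [|b Ob]; first exact: unitary_conj_star_endo.
      rewrite /psi text// (Ucomm _).2; first by rewrite -mulrA uU.2 mulr1.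
      by apply: Pa; exists b.
    (* Uniqueness gives [tlam u = U * tlam u * star U]; multiplying by [U] on the right yields the
       commutation. *)
    by rewrite [in RHS](tuniq _ psiE) /psi -!mulrA uU.1 mulr1.
  - by rewrite mulrDl mulrDr Pa// Pb.
  - by rewrite -scalerAl -scalerAr Pa.
(* [x] and [star x] both lie in [P], so both commute with [tlam u], hence [x] commutes with all of
   the C*-algebra generated by [tlam u]. *)
by apply: rel_commutant_cstar_gen1; apply: PV => //; exact: Ps.
Qed.
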